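(* Assume that each data holder shares an $\varepsilon$-differentially private local model. Then the global model that results by aggregating the local models according to the algorithm ''Sharing the Noisy Model'' also satisfies $\varepsilon$-differential privacy for any dataset $D_j$, $j\in\{1,\dots,M\}$.
   Context: Data: $M$ data holders possess datasets $D_1,\dots,D_M$ of records (tuples of values of $N$ attributes with finite domains), $n_j=|D_j|$. Each record is held by exactly one holder. Differential privacy (bounded version): two datasets are adjacent if one is obtained from the other by changing the value of a single record (so they have the same size). A randomized algorithm $\mathbf{Alg}$ is $\varepsilon$-differentially private if for all sets $O$ of outputs and all adjacent $D,D'$, $\mathbb{P}[\mathbf{Alg}(D)\in O]\le e^{\varepsilon}\,\mathbb{P}[\mathbf{Alg}(D')\in O]$. ''For any dataset $D_j$'' means that this holds with $D_j$ as the input that is changed to an adjacent dataset, the other holders' datasets being fixed. A (Bayesian Network) model is a pair $(\mathcal{G},\Theta)$: a directed acyclic graph $\mathcal{G}$ on the attributes and a family $\Theta$ of conditional distributions of each attribute given its parents in $\mathcal{G}$; it encodes the product distribution $\prod_i\mathbf{p}_{X_i\mid\mathbf{Pa}(X_i)}$. Holder $j$ produces its local model $(\mathcal{G}^{(j)},\Theta^{(j)})$ from $D_j$ by an $\varepsilon$-differentially private randomized algorithm, independently of the other holders. Sharing the Noisy Model: the analyst obtains from each holder $j$ the local model $(\mathcal{G}^{(j)},\Theta^{(j)})$ and the dataset size $n_j$; it draws a synthetic dataset $D_{j,synth}$ of $n_j$ independent samples from the distribution encoded by the local model, and lets $D_{synth}$ be the union of all $D_{j,synth}$. From $D_{synth}$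 alone it learns, without further access to any $D_j$, the global model: the structure greedily (start from an arbitrary attribute in a set $V$; $N-1$ times add the pair $(X,\mathbf{Pa}(X))$, $X\notin V$, $\mathbf{Pa}(X)\subseteq V$, $|\mathbf{Pa}(X)|\le k$, of largest empirical mutual information in $D_{synth}$, and add $X$ to $V$) and the parameters from the empirical frequency distributions of $D_{synth}$. *)

(* Defs.v *)
From HB Require Import structures.
From mathcomp Require Import all_boot all_order all_algebra.
From mathcomp Require Import all_classical all_reals all_analysis.
From mathcomp Require Import measurable_realfun.

Set Implicit Arguments.
Unset Strict Implicit.
Unset Printing Implicit Defensive.

Import Order.TTheory GRing.Theory Num.Theory.
Import numFieldNormedType.Exports.

Local Open Scope classical_set_scope.
Local Open Scope ring_scope.

Record schema := Schema {
  attr : finType;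
  dom : attr -> finType;
  dom_gt0 : forall x, (0 < #|dom x|)%N }.
Arguments dom {s} x.

Section records.
Variable A : schema.

Definition record := {dffun forall x : attr A, dom x}.

Definition config (P : {set attr A}) :=
  {dffun forall x : {x : attr A | x \in P}, dom (val x)}.

Definition restr (P : {set attr A}) (r : record) : config P :=
  [ffun x : {x : attr A | x \in P} => r (val x)].

(* Adjacency is positional: a bag of records is a sequence up to reordering,
   and an algorithm on bags is an order-invariant algorithm on sequences. *)
Definition dataset := seq record.

Definition adjacent (D D' : dataset) : Prop :=
  exists (s1 s2 : dataset) (r r' : record),
    [/\ r != r', D = s1 ++ r :: s2 & D' = s1 ++ r' :: s2].

End records.
Arguments restr {A} P r.

Definition diff_private (A : schema) d (T : measurableType d) (R : realType)
    (eps : R) (alg : dataset A -> probability T R) : Prop :=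
  forall O : set T, measurable O -> forall D D' : dataset A, adjacent D D' ->
    (alg D O <= (expR eps)%:E * alg D' O)%E.

(* [pa x] is the set of parents of [x]: the edges are the (y, x), y in pa x. *)
Definition edge (V : finType) (pa : V -> {set V}) : rel V :=
  fun y x => y \in pa x.

Definition acyclic (V : finType) (e : rel V) : Prop :=
  forall c : seq V, cycle e c -> c = [::].

Record model (R : realType) (A : schema) := Model {
  pa : {ffun attr A -> {set attr A}};
  cpd : forall x : attr A, config (pa x) -> dom x -> R;
  _ : acyclic (edge pa);
  _ : forall x u v, 0 <= @cpd x u v;
  _ : forall x u, \sum_v @cpd x u v = 1 }.
Arguments cpd {R A} m x u v.

Section models.
Variables (R : realType) (A : schema).
Implicit Types (m : model R A) (r : record A).

Lemma pa_acyclic m : acyclic (edge (pa m)). Proof. by case: m. Qed.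

Lemma cpd_ge0 m x u v : 0 <= cpd m x u v. Proof. by case: m u. Qed.

Lemma cpd_sum1 m x u : \sum_v cpd m x u v = 1. Proof. by case: m u. Qed.

Definition cond_prob m (x : attr A) r (v : dom x) : R :=
  cpd m x (restr (pa m x) r) v.

Definition joint m r : R := \prod_x cond_prob m r (r x).

Lemma joint_ge0 m r : 0 <= joint m r.
Proof. by apply: prodr_ge0 => x _; exact: cpd_ge0. Qed.

Lemma acyclic_sink m (S : {set attr A}) : S != finset.set0 ->
  exists2 x, x \in S & forall y, y \in S -> x \notin pa m y.
Proof.
case/finset.set0Pn => x0 x0S.
pose e := edge (pa m).
case: (@arg_minnP _ x0 (fun x => x \in S) (fun x => #|connect e x|) x0S).
move=> x xS xmin; exists x => // y yS; apply/negP => exy.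
have sub : connect e y \subset connect e x.
  by apply/fintype.subsetP => z; apply: connect_trans; exact: connect1.
have /eqP eqc : #|connect e y| == #|connect e x|.
  by rewrite eqn_leq xmin ?andbT// subset_leq_card.
have /subset_cardP/(_ sub)/(_ x) := eqc.
rewrite [RHS]connect0 => /connectP[p yp xE].
have := @pa_acyclic m (y :: p).
by rewrite /cycle rcons_path yp /= -xE => /(_ exy).
Qed.

Definition upd r (x : attr A) (v : dom x) : record A :=
  [ffun y => eqtype.dfwith r v y].

Lemma upd_in r x (v : dom x) : upd r v x = v.
Proof. by rewrite ffunE dfwith_in. Qed.

Lemma upd_out r x (v : dom x) y : y != x -> upd r v y = r y.
Proof. by rewrite eq_sym => xy; rewrite ffunE dfwith_out. Qed.

Lemma sum_upd (x : attr A) (f : record A -> R) :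
  \sum_r \sum_(v : dom x) f (upd r v) = #|dom x|%:R * \sum_r f r.
Proof.
pose h (p : record A * dom x) := (upd p.1 p.2, p.1 x).
have hK : involutive h.
  case=> r v; congr pair => /=; last exact: upd_in.
  apply/ffunP => y; have [->|yx] := eqVneq y x; first by rewrite upd_in.
  by rewrite !upd_out.
rewrite pair_big /=.
rewrite (reindex_inj (inv_inj hK)) /=.
rewrite (eq_bigr (fun p : record A * dom x => f p.1)); last first.
  by move=> p _; rewrite -[in RHS](hK p).
rewrite -(pair_big xpredT xpredT (fun r (_ : dom x) => f r)) /=.
rewrite big_distrr /=; apply: eq_bigr => r _.
by rewrite sumr_const mulr_natl.
Qed.

Lemma cond_prob_upd m x (v : dom x) r y (w : dom y) : x \notin pa m y ->
  cond_prob m (upd r v) w = cond_prob m r w.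
Proof.
move=> xy; rewrite /cond_prob; congr (cpd m y _ w).
apply/ffunP => -[z zy]; rewrite !ffunE /=; apply: dfwith_out.
by apply: contraNneq xy => ->.
Qed.

Lemma sum_prod_cond_prob m (S : {set attr A}) :
  (\sum_r \prod_(x in S) cond_prob m r (r x)) *
    \prod_(x in S) #|dom x|%:R = #|{: record A}|%:R :> R.
Proof.
have [n] := ubnP #|S|; elim: n S => // n IH S; rewrite ltnS => Sn.
have [->|S0] := eqVneq S finset.set0.
  by rewrite !big_set0 mulr1 (eq_bigr (fun=> 1)) ?sumr_const//= => r _;
     rewrite big_set0.
have [x xS sink] := acyclic_sink m S0.
rewrite (big_setD1 x xS) /= mulrA -[RHS](IH (S :\ x)%SET); last first.
  by move: Sn; rewrite (cardsD1 x) xS.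
congr (_ * _); rewrite mulrC -sum_upd; apply: eq_bigr => r _.
rewrite (eq_bigr (fun v : dom x => cond_prob m r v *
    \prod_(y in (S :\ x)%SET) cond_prob m r (r y))); last first.
  move=> v _; rewrite (big_setD1 x xS) /= upd_in cond_prob_upd ?sink//.
  congr (_ * _); apply: eq_bigr => y; rewrite !inE => /andP[yx yS].
  by rewrite upd_out// cond_prob_upd ?sink.
by rewrite -big_distrl /= cpd_sum1 mul1r.
Qed.

Lemma joint_sum1 m : \sum_r joint m r = 1.
Proof.
have := sum_prod_cond_prob m [set: attr A]%SET.
have -> : #|{: record A}|%:R = \prod_(x in [set: attr A]%SET) #|dom x|%:R :> R.
  rewrite card_dep_ffun foldrE big_map -natr_prod big_enum /=.
  by congr (_%:R); apply: eq_bigl => x; rewrite !inE.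
have nz : \prod_(x in [set: attr A]%SET) #|dom x|%:R != 0 :> R.
  by apply/prodf_neq0 => x _; rewrite pnatr_eq0 -lt0n dom_gt0.
rewrite -[RHS in _ = RHS -> _]mul1r => /(mulIf nz) <-.
apply: eq_bigr => r _; rewrite /joint.
by apply: eq_bigl => x; rewrite inE.
Qed.

End models.

Section model_measurable.
Variables (R : realType) (A : schema).

Definition no_edge : {ffun attr A -> {set attr A}} := [ffun=> finset.set0].

Lemma acyclic_no_edge : acyclic (edge no_edge).
Proof.
case=> [//|x c]; rewrite /cycle.
by case: c => [|y c] /=; rewrite {1}/edge ffunE inE.
Qed.

Definition uniform (x : attr A) (u : config (no_edge x)) (v : dom x) : R :=
  #|dom x|%:R^-1.

Lemma uniform_ge0 x u v : 0 <= @uniform x u v.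
Proof. by rewrite invr_ge0. Qed.

Lemma uniform_sum1 x u : \sum_v @uniform x u v = 1.
Proof.
rewrite sumr_const -[_ *+ _]mulr_natl divff// pnatr_eq0 -lt0n.
exact: dom_gt0.
Qed.

Definition uniform_model : model R A :=
  Model acyclic_no_edge uniform_ge0 uniform_sum1.

HB.instance Definition _ := gen_eqMixin (model R A).
HB.instance Definition _ := gen_choiceMixin (model R A).
HB.instance Definition _ := isPointed.Build (model R A) uniform_model.

(* The sigma-algebra generated by the graph and by all the entries of the
   conditional probability tables; as the domains are nonempty, every parent
   configuration is the restriction of a record. *)
Definition model_generators : set (set (model R A)) :=
  [set U | (exists g, U = [set m | pa m = g]) \/
    (exists x r (v : dom x) (B : set R),
       measurable B /\ U = [set m | B (cond_prob m r v)])].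

Definition model_display : measure_display.
Proof. exact: sigma_display model_generators. Qed.

HB.instance Definition _ := @isMeasurable.Build model_display (model R A)
  <<s model_generators >>
  (@sigma_algebra0 _ setT model_generators)
  (@sigma_algebraC _ model_generators)
  (@sigma_algebra_bigcup _ setT model_generators).

Lemma measurable_cond_prob (x : attr A) (r : record A) (v : dom x) :
  measurable_fun [set: model R A] (fun m => cond_prob m r v).
Proof.
move=> _ B mB; rewrite setTI; apply: sub_sigma_algebra; right.
by exists x, r, v, B.
Qed.

Lemma measurable_joint (r : record A) :
  measurable_fun [set: model R A] (fun m => joint m r).
Proof.
rewrite /joint; apply: measurable_prod => x _.
exact: measurable_cond_prob.
Qed.

End model_measurable.

Section learning.
Variables (R : realType) (A : schema).
Implicit Types (s : dataset A) (x : attr A) (P : {set attr A}).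

Definition freq s (p : pred (record A)) : R := (count p s)%:R / (size s)%:R.

Definition emp_joint s x P (v : dom x) (u : config P) : R :=
  freq s (fun r => (r x == v) && (restr P r == u)).

Definition emp_val s x (v : dom x) : R := freq s (fun r => r x == v).

Definition emp_config s P (u : config P) : R := freq s (fun r => restr P r == u).

(* A term with zero joint frequency vanishes, as it should, since 0 * _ = 0. *)
Definition mutual_info s x P : R :=
  \sum_(v : dom x) \sum_(u : config P)
    emp_joint s v u * ln (emp_joint s v u / (emp_val s v * emp_config s u)).

Definition candidate k (V : {set attr A}) x P : bool :=
  [&& x \notin V, P \subset V & (#|P| <= k)%N].

(* [greedy k s n V g]: starting from some attribute and breaking ties in some
   way, V and g are the attribute set and the parent map after n additions. *)
Inductive greedy (k : nat) s :
    nat -> {set attr A} -> {ffun attr A -> {set attr A}} -> Prop :=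
| greedy_start x0 : greedy k s 0 [set x0]%SET (no_edge A)
| greedy_add n V g x P :
    greedy k s n V g ->
    candidate k V x P ->
    (forall y Q, candidate k V y Q -> mutual_info s y Q <= mutual_info s x P) ->
    greedy k s n.+1 (x |: V)%SET [ffun y => if y == x then P else g y].

(* A parent configuration absent from s has no empirical conditional
   distribution: the model is then unconstrained. *)
Definition learned k s (m : model R A) : Prop :=
  (exists V, greedy k s #|attr A|.-1 V (pa m)) /\
  forall x (u : config (pa m x)) (v : dom x),
    0 < emp_config s u -> cpd m x u v = emp_joint s v u / emp_config s u.

(* The choices left open by the procedure may be made at random. *)
Definition learner k (learn : dataset A -> probability (model R A) R) : Prop :=
  forall s, {ae learn s, forall m, learned k s m}.

End learning.

Section learner_exists.
Variables (R : realType) (A : schema).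

Lemma ranked_acyclic (V : finType) (e : rel V) (f : V -> nat) :
  (forall y x, e y x -> (f y < f x)%N) -> acyclic e.
Proof.
move=> ef [//|x c]; rewrite /cycle => xc.
have : path (fun y x => f y < f x)%N x (rcons c x).
  exact: sub_path xc.
rewrite path_sortedE; last by move=> a b d; apply: ltn_trans.
by case/andP => /allP /(_ x); rewrite mem_rcons inE eqxx ltnn => /(_ isT).
Qed.

Lemma greedy_exists k (s : dataset A) n : (n < #|attr A|)%N ->
  exists V (g : {ffun attr A -> {set attr A}}) (f : attr A -> nat),
  [/\ @greedy R A k s n V g, #|V| = n.+1,
   forall y x, y \in g x -> [/\ y \in V, x \in V & (f y < f x)%N] &
   forall x, (f x <= n)%N].
Proof.
elim: n => [/card_gt0P[x0 _]|n IH nA].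
  exists [set x0]%SET, (no_edge A), (fun=> 0%N); split => //.
  - exact: greedy_start.
  - by rewrite cards1.
  - by move=> y x; rewrite ffunE finset.in_set0.
have [V [g [f [gV cV gf fn]]]] := IH (ltnW nA).
have [x0 x0V] : exists x, x \notin V.
  apply/existsP; rewrite -negb_forall; apply: contraTN nA => /forallP VT.
  rewrite -leqNgt -cV; apply: subset_leq_card; apply/fintype.subsetP => x _; exact: VT.
pose c (p : attr A * {set attr A}) := candidate k V p.1 p.2.
have c0 : c (x0, finset.set0) by rewrite /c /candidate /= x0V finset.sub0set cards0.
case: (@arg_maxP _ _ _ (x0, finset.set0) c (fun p => @mutual_info R A s p.1 p.2) c0) => -[x P] /= cxP mx.
case/and3P: (cxP) => xV PV _ /=.
exists (x |: V)%SET, [ffun y => if y == x then P else g y], (fun y => if y == x then n.+1 else f y); split.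
- by apply: greedy_add cxP _ => // y Q cyQ; exact: (mx (y, Q) cyQ).
- by rewrite cardsU1 xV cV.
- move=> y z; rewrite ffunE !inE; case: (eqVneq z x) => [-> yP|zx /gf[yV zV fyz]].
    have yV : y \in V by move/fintype.subsetP: PV; apply.
    rewrite yV orbT; split => //; case: eqP => [yx|_]; last by rewrite ltnS.
    by rewrite -yx yV in xV.
  rewrite yV zV !orbT; split => //; case: eqP => // yx.
  by rewrite -yx yV in xV.
- by move=> y; case: eqP => // _; exact: leqW.
Qed.

Definition emp_cpd (s : dataset A) (g : {ffun attr A -> {set attr A}}) x (u : config (g x)) (v : dom x) : R :=
  if 0 < emp_config R s u then emp_joint R s v u / emp_config R s u else #|dom x|%:R^-1.

Lemma emp_cpd_ge0 s g x u v : 0 <= @emp_cpd s g x u v.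
Proof.
rewrite /emp_cpd; case: ifP => [u0|_]; last by rewrite invr_ge0.
by apply: divr_ge0 (ltW u0); rewrite /emp_joint /freq divr_ge0.
Qed.

Lemma emp_cpd_sum1 s g x u : \sum_v @emp_cpd s g x u v = 1.
Proof.
rewrite /emp_cpd; case: (boolP (0 < emp_config R s u)) => [u0|_]; last first.
  rewrite sumr_const -[LHS]mulr_natl divff// pnatr_eq0 -lt0n.
  exact: dom_gt0.
rewrite -mulr_suml; suff -> : \sum_(v : dom x) emp_joint R s v u = emp_config R s u.
  by rewrite divff// gt_eqF.
rewrite /emp_joint /emp_config /freq.
rewrite -mulr_suml -natr_sum; congr (_%:R / _).
elim: s {u0} => [|r s IH] /=; first by rewrite big1.
rewrite big_split /= IH; congr (_ + _)%N.
rewrite (bigD1 (r x))//= eqxx /= big1 ?addn0// => v.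
by rewrite eq_sym => /negPf ->.
Qed.

Lemma model_eq (m m' : model R A) : pa m = pa m' ->
  (forall x r (v : dom x), cond_prob m r v = cond_prob m' r v) -> m = m'.
Proof.
case: m => g c ac c0 c1; case: m' => g' c' ac' c0' c1' /= gg'.
case: _ / gg' in c' ac' c0' c1' *.
rewrite /cond_prob /= => cc'.
have E : c = c'.
  apply: functional_extensionality_dep => x; apply/funext => u; apply/funext => v.
  have d0 (y : attr A) : dom y.
    by have /card_gt0P/sigW[] := dom_gt0 y.
  pose r : record A := [ffun y => if pselect (y \in g x) is left h then u (exist _ y h) else d0 y].
  have <- : restr (g x) r = u; last exact: cc'.
  apply/ffunP => -[y yg]; rewrite !ffunE /=; case: pselect => // h.
  by congr (u (exist _ y _)); exact: bool_irrelevance.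
case: _ / E in c0' c1' cc' *.
by congr Model; exact: Prop_irrelevance.
Qed.

Lemma measurable_set1_model (m : model R A) : measurable [set m].
Proof.
have -> : [set m] = [set m' | pa m' = pa m] `&`
   \bigcap_(p in [set: {x : attr A & (record A * dom x)%type}]) [set m' | [set cond_prob m (tagged p).1 (tagged p).2] (cond_prob m' (tagged p).1 (tagged p).2)].
  apply/seteqP; split=> [m' ->//|m' /= [pam h]].
  apply: model_eq => // x r v.
  exact: (h (Tagged (fun x => (record A * dom x)%type) (r, v)) I).
apply: measurableI.
  by apply: sub_sigma_algebra; left; exists (pa m).
apply: fin_bigcap_measurable; first exact: finite_finset.
move=> [x [r v]] _; apply: sub_sigma_algebra; right.
by exists x, r, v, [set cond_prob m r v]; split.
Qed.

(* The hypothesis [learner] is satisfiable as soon as there is an attribute. *)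
Lemma learner_exists k : (0 < #|attr A|)%N -> exists learn, @learner R A k learn.
Proof.
move=> A0.
have lm (s : dataset A) : exists m : model R A, learned k s m.
  have ltA : (#|attr A|.-1 < #|attr A|)%N by rewrite prednK.
  have [V [g [f [gV _ gf _]]]] := @greedy_exists k s _ ltA.
  have ag : acyclic (edge g).
    by apply: (@ranked_acyclic _ _ f) => y x /gf[].
  exists (Model ag (@emp_cpd_ge0 s g) (@emp_cpd_sum1 s g)); split; first by exists V.
  by move=> x u v /= u0; rewrite /emp_cpd u0.
pose m s := sval (cid (lm s)).
exists (fun s => \d_(m s) : probability (model R A) R) => s.
exists (~` [set m s]); split.
- by apply: measurableC; exact: measurable_set1_model.
- have nm : (m s \in ~` [set m s]) = false by apply/negbTE; rewrite notin_setE => /=; exact.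
  by rewrite /= diracE nm.
- by move=> m' /= nl mm'; apply: nl; rewrite mm'; exact: (svalP (cid (lm s))).
Qed.

End learner_exists.

Section product_law.
Context d (T : measurableType d) (R : realType).

Definition tuple_cons n (p : T * n.-tuple T) : n.+1.-tuple T :=
  [tuple of p.1 :: p.2].

Lemma measurable_tuple_cons n : measurable_fun setT (@tuple_cons n).
Proof. exact: measurable_cons. Qed.

HB.instance Definition _ n :=
  isMeasurableFun.Build _ _ _ _ (@tuple_cons n) (@measurable_tuple_cons n).

Fixpoint product_law n : ('I_n -> probability T R) ->
    probability (n.-tuple T) R :=
  match n with
  | 0 => fun _ => \d_([tuple] : 0.-tuple T)
  | n'.+1 => fun P =>
      distribution (P ord0 \x product_law (fun i => P (lift ord0 i)))%E
        (@tuple_cons n')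
  end.

End product_law.

Section sharing.
Variables (R : realType) (A : schema) (M : nat) (n : 'I_M -> nat).
Variable P : 'I_M -> probability (model R A) R.
Variable learn : dataset A -> probability (model R A) R.

(* Samples are indexed by pairs (j, i): the i-th sample for holder j. *)
Definition samples := {ffun {j : 'I_M & 'I_(n j)} -> record A}.

Definition synth_data (S : samples) (j : 'I_M) : dataset A :=
  [seq S (Tagged (fun j => 'I_(n j)) i) | i <- enum 'I_(n j)].

Definition synth_union (S : samples) : dataset A :=
  flatten [seq synth_data S j | j <- enum 'I_M].

Definition samples_pmf (m : M.-tuple (model R A)) (S : samples) : R :=
  \prod_p joint (tnth m (tag p)) (S p).

Definition samples_prob (S : samples) : \bar R :=
  \int[product_law P]_m (samples_pmf m S)%:E.

Definition global_law (O : set (model R A)) : \bar R :=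
  (\sum_(S : samples) samples_prob S * learn (synth_union S) O)%E.

Lemma samples_pmf_ge0 m S : 0 <= samples_pmf m S.
Proof. by apply: prodr_ge0 => p _; exact: joint_ge0. Qed.

Lemma measurable_samples_pmf S : measurable_fun setT (samples_pmf ^~ S).
Proof.
apply: measurable_prod => p _.
apply: (@measurableT_comp _ _ _ _ _ _ (fun m : model R A => joint m (S p))).
  exact: measurable_joint.
exact: measurable_tnth.
Qed.

Lemma samples_pmf_sum1 m : \sum_S samples_pmf m S = 1.
Proof.
rewrite /samples_pmf.
rewrite -(bigA_distr_bigA (fun (p : {j : 'I_M & 'I_(n j)}) (r : record A) =>
  joint (tnth m (tag p)) r)).
by apply: big1 => p _; exact: joint_sum1.
Qed.

Lemma samples_prob_ge0 S : (0 <= samples_prob S)%E.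
Proof. by apply: integral_ge0 => m _; rewrite lee_fin samples_pmf_ge0. Qed.

Lemma samples_prob_sum1 : (\sum_S samples_prob S = 1)%E.
Proof.
rewrite /samples_prob -ge0_integral_sum//=; last 2 first.
- by move=> S; apply/measurable_EFinP; exact: measurable_samples_pmf.
- by move=> S m _; rewrite lee_fin samples_pmf_ge0.
under eq_integral do rewrite sumEFin samples_pmf_sum1.
by rewrite integral_cst// mul1e; exact: probability_setT.
Qed.

Lemma samples_prob_fin_num S : samples_prob S \is a fin_num.
Proof.
rewrite ge0_fin_numE ?samples_prob_ge0// (@le_lt_trans _ _ 1%E) ?ltry//.
rewrite -samples_prob_sum1 (bigD1 S)//= leeDl// sume_ge0// => ? _.
exact: samples_prob_ge0.
Qed.

Let law0 : global_law set0 = 0%E.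
Proof. by apply: big1 => S _; rewrite measure0 mule0. Qed.

Let law_ge0 O : (0 <= global_law O)%E.
Proof.
by apply: sume_ge0 => S _; apply: mule_ge0 => //; exact: samples_prob_ge0.
Qed.

Let law_sigma_additive : semi_sigma_additive global_law.
Proof.
move=> F mF tF mUF.
rewrite [X in _ --> X](_ : _ =
    lim ((fun n => \sum_(0 <= i < n) global_law (F i))%E @ \oo)).
  by apply: is_cvg_ereal_nneg_natsum => k _; exact: law_ge0.
rewrite /global_law nneseries_sum//; last first.
  by move=> S k _; apply: mule_ge0 => //; exact: samples_prob_ge0.
apply: eq_bigr => S _.
rewrite -(fineK (samples_prob_fin_num S)) nneseriesZl//; congr (_ * _)%E.
exact: measure_semi_bigcup.
Qed.

HB.instance Definition _ := isMeasure.Build _ _ _ global_law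
  law0 law_ge0 law_sigma_additive.

Let law_setT : global_law setT = 1%E.
Proof.
rewrite -[RHS]samples_prob_sum1; apply: eq_bigr => S _.
by rewrite probability_setT mule1.
Qed.

HB.instance Definition _ :=
  Measure_isProbability.Build _ _ _ global_law law_setT.

End sharing.

(* The global model obtained from the holders' algorithms run independently on
   the datasets D: the analyst gets the local models and the dataset sizes. *)
Definition sharing_noisy_model (R : realType) (A : schema) (M : nat)
    (alg : 'I_M -> dataset A -> probability (model R A) R)
    (learn : dataset A -> probability (model R A) R)
    (D : 'I_M -> dataset A) : probability (model R A) R :=
  global_law (fun j => size (D j)) (fun j => alg j (D j)) learn.

(* Main.v *)
Require Import Defs.
From mathcomp Require Import all_boot all_order all_algebra.
From mathcomp Require Import all_classical all_reals all_analysis.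
From mathcomp Require Import measurable_realfun.
Local Open Scope ring_scope.

(** For a factor c, domination of measures P O <= c P' O passes to integrals of
nonnegative functions. By Fubini, changing one factor of a product measure by at
most c changes the product by at most c. The analyst's output law is a sum of
integrals of nonnegative functions against the product of the laws of the local
models, and it uses the private datasets only through these laws and through
the sizes, which adjacency preserves; so it inherits c = exp(eps). *)

Definition dominates {d} {T : measurableType d} {R : realType} (c : R)
    (mu nu : set T -> \bar R) : Prop :=
  forall O, measurable O -> (mu O <= c%:E * nu O)%E.

(** Scaling [nu] by [c] gives a measure again, and integrals of nonnegative functions are monotone
    in the measure. *)
Lemma dominates_integral {d} {T : measurableType d} {R : realType} (c : R)
    (mu nu : {measure set T -> \bar R}) (f : T -> \bar R) :
  0 <= c -> dominates c mu nu ->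
  (forall x, 0 <= f x)%E -> measurable_fun setT f ->
  (\int[mu]_x f x <= c%:E * \int[nu]_x f x)%E.
Proof.
move=> c0 mn f0 mf; have -> : c = (NngNum c0)%:num by [].
rewrite -(@ge0_integral_mscale _ _ _ nu _ _ (NngNum c0) f)//.
exact: ge0_le_measure_integral.
Qed.

(** The product measure of [O] is the integral, against the first factor, of the [nu]-measure of the
    sections of [O]; only the integrating measure changes. *)
Lemma dominates_prodl {d1 d2} {T1 : measurableType d1} {T2 : measurableType d2}
    {R : realType} (c : R) (mu mu' : {measure set T1 -> \bar R})
    (nu : {sigma_finite_measure set T2 -> \bar R}) :
  0 <= c -> dominates c mu mu' -> dominates c (mu \x nu)%E (mu' \x nu)%E.
Proof.
move=> c0 mm O mO; apply: dominates_integral => //=.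
exact: measurable_fun_xsection.
Qed.

(** Here the integrand changes instead, and the bound holds section by section. *)
Lemma dominates_prodr {d1 d2} {T1 : measurableType d1} {T2 : measurableType d2}
    {R : realType} (c : R) (mu : {measure set T1 -> \bar R})
    (nu nu' : {sigma_finite_measure set T2 -> \bar R}) :
  0 <= c -> dominates c nu nu' -> dominates c (mu \x nu)%E (mu \x nu')%E.
Proof.
move=> c0 nn O mO; rewrite /product_measure1.
have mnu' := @measurable_fun_xsection _ _ T1 T2 R nu' O mO.
rewrite -ge0_integralZl_EFin//; apply: ge0_le_integral => //=.
- exact: measurable_fun_xsection.
- exact: measurable_funeM.
- by move=> x _; apply: nn; exact: measurable_xsection.
Qed.

(** A single coordinate differs, so [c] enters once and not once per factor. *)
Lemma dominates_product_law {d} {T : measurableType d} {R : realType} {M : nat}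
    (c : R) (P P' : 'I_M -> probability T R) (j : 'I_M) :
  0 <= c -> dominates c (P j) (P' j) -> (forall i, i != j -> P i = P' i) ->
  dominates c (product_law P) (product_law P').
Proof.
move=> c0; elim: M P P' j => [P P' []//|M IH] P P' j Pj PP' O mO /=.
have mO' : measurable (@tuple_cons _ T M @^-1` O).
  by rewrite -[X in measurable X]setTI; exact: measurable_tuple_cons.
rewrite /distribution /pushforward /=.
(* If [j] lies in the tail, the heads agree and induction applies; if [j] is the head, the tails
   agree. *)
have [j'|] := unliftP ord0 j => jE.
  rewrite (PP' ord0) ?jE//; apply: dominates_prodr => //.
  apply: (IH _ _ j'); first by rewrite -jE.
  by move=> i ij; apply: PP'; rewrite jE (inj_eq lift_inj).
have -> : (fun i => P (lift ord0 i)) = (fun i => P' (lift ord0 i)).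
  by apply/funext => i; apply: PP'; rewrite jE.
by apply: dominates_prodl => //; rewrite -jE.
Qed.

(** Post-processing: the weights [learn (synth_union S) O] are common to both sums, so only the
    [samples_prob S] need comparing. *)
Lemma dominates_global_law {R : realType} {A : schema} {M : nat}
    (n : 'I_M -> nat) (c : R) (P P' : 'I_M -> probability (model R A) R)
    (learn : dataset A -> probability (model R A) R) :
  0 <= c -> dominates c (product_law P) (product_law P') ->
  dominates c (global_law n P learn) (global_law n P' learn).
Proof.
move=> c0 PP' O mO; rewrite /global_law ge0_sume_distrr; last first.
  by move=> S _; apply: mule_ge0 => //; exact: samples_prob_ge0.
apply: lee_sum => S _; rewrite muleA; apply: lee_wpmul2r => //.
apply: dominates_integral => //.
- by move=> m; rewrite lee_fin samples_pmf_ge0.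
- by apply/measurable_EFinP; exact: measurable_samples_pmf.
Qed.

Theorem theorem3p8 (R : realType) (A : schema) (M k : nat) (eps : R)
    (alg : 'I_M -> dataset A -> probability (model R A) R)
    (learn : dataset A -> probability (model R A) R) :
  (forall j, diff_private eps (alg j)) ->
  learner k learn ->
  forall (D : 'I_M -> dataset A) (j : 'I_M),
    diff_private eps (fun Dj : dataset A =>
      sharing_noisy_model alg learn [eta D with j |-> Dj]).
Proof.
move=> dp _ D j O mO D1 D2 D12.
(* The type [samples n] indexing the sum in [global_law] depends on the sizes, so these are
   identified before the laws are compared. *)
have size12 : (fun i => size ([eta D with j |-> D1] i)) =
              (fun i => size ([eta D with j |-> D2] i)).
  apply/funext => i /=; case: eqP => // _.
  by case: D12 => [s1 [s2 [r [r' [_ -> ->]]]]]; rewrite !size_cat.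
rewrite /sharing_noisy_model size12.
have c0 : 0 <= expR eps by exact: expR_ge0.
apply: dominates_global_law => //; apply: (dominates_product_law _ _ _ j) => //.
- by move=> U mU; rewrite /= eqxx; exact: dp.
- by move=> i ij /=; rewrite (negPf ij).
Qed.
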